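(* Let $M$ be any fixed finite monoid. Then the space complexity of the out-of-order evaluation problem for $M$ is as follows: \begin{itemize} \item if $M\in\mathbf{Com}$, then it is in $O(1)$; \item if $M\in(\mathbf{FL}\lor\mathbf{Com})\setminus\mathbf{Com}$, then it is in $\Theta(\log n)$; \item otherwise (i.e., if $M\notin\mathbf{FL}\lor\mathbf{Com}$), it is in $\Theta(n)$. \end{itemize}
   Context: Problem. All monoids are finite. Let $w=w[1]\cdots w[n]$ be a word of length $n>0$ over a fixed monoid $M$ and let $\pi$ be a permutation of $\{1,\ldots,n\}$. The out-of-order stream of $w$ defined by $\pi$ is the sequence of triples $(w[\pi(i)],\pi(i),n)$ for $i=1,\ldots,n$. In the out-of-order evaluation problem for $M$, the algorithm receives the triples one after the other, for arbitrary $w$ and arbitrary $\pi$, and must output at the end the product $w[1]\cdot\cdots\cdot w[n]$ in $M$. The length $n$ is known and not counted in the space. Space. Algorithms are deterministic, and only the bits memorized between two consecutive stream elements are counted (computation time and interim memory used while processing an element are ignored). Formally, an algorithm using $s(n)$ bits consists, for each $n\ge 1$, of a set $Q_n$ of memory states with $|Q_n|\le 2^{s(n)}$, an initial state, an update function $Q_n\times M\times\{1,\ldots,n\}\to Q_n$, and an output function $Q_n\to M$, such that for every $w\in M^n$ and every permutation $\pi$ the output after processing the stream is the product of $w$. The problem has space complexity $O(g(n))$ if some algorithm uses $s(n)=O(g(n))$ bits; it has space complexity $\Omega(g(n))$ if every algorithm uses $s(n)=\Omega(g(n))$ bits, where $s=\Omega(g)$ means $\limsup_{n\to\infty}s(n)/g(n)>0$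 (Hardy--Littlewood convention). $\Theta(g(n))$ means both $O(g(n))$ and $\Omega(g(n))$ in these senses. Varieties. A variety of monoids is a class of finite monoids closed under direct products, sub-monoids (with the same neutral element), and quotients by congruences. The join $\mathbf V\lor\mathbf W$ of two varieties is the smallest variety containing both $\mathbf V$ and $\mathbf W$. The idempotent power of a finite monoid $M$ is the smallest positive integer $\omega$ such that $x^\omega=x^{2\omega}$ for all $x\in M$. $\mathbf{Com}$ is the variety of commutative monoids. $\mathbf{FL}$ is the variety of monoids $M$ satisfying $(xy)^\omega st(xz)^\omega=(xy)^\omega sxt(xz)^\omega$ for all $x,y,z,s,t\in M$. *)

(* Defs.v *)
From HB Require Import structures.
From mathcomp Require Import all_boot all_order all_algebra all_fingroup.
From mathcomp Require Import all_classical all_reals all_analysis.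

Set Implicit Arguments.
Unset Strict Implicit.
Unset Printing Implicit Defensive.

Import Order.TTheory GRing.Theory Num.Theory.
Import numFieldNormedType.Exports.

(* HB cannot declare the join of Finite and Monoid here, because fingroup
   already provides FinStarMonoid above both; hence a record with instances on
   its carrier. *)
Record finMonoidType := FinMonoid {
  fm_base : finType;
  fm_one : fm_base;
  fm_mul : fm_base -> fm_base -> fm_base;
  fm_mulA : associative fm_mul;
  fm_mul1m : left_id fm_one fm_mul;
  fm_mulm1 : right_id fm_one fm_mul
}.

Definition fm_sort (M : finMonoidType) : Type := fm_base M.
Coercion fm_sort : finMonoidType >-> Sortclass.

HB.instance Definition _ (M : finMonoidType) := Finite.on (fm_sort M).
HB.instance Definition _ (M : finMonoidType) :=
  isMonoid.Build (fm_sort M) (@fm_mulA M) (@fm_mul1m M) (@fm_mulm1 M).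

(* The direct product, with the library's componentwise operations on pairs. *)
Definition prod_finMonoid (M N : finMonoidType) : finMonoidType :=
  @FinMonoid (M * N)%type _ _
    (@mulgA (M * N)%type) (@mul1g (M * N)%type) (@mulg1 (M * N)%type).

(* A class of finite monoids.  Sub-monoids are presented by injective monoid
   morphisms and quotients by congruences as surjective ones, so that a class
   with these closure properties is invariant under isomorphism. *)
Definition finMonoidClass := finMonoidType -> Prop.

Definition closed_under_products (V : finMonoidClass) : Prop :=
  forall M N : finMonoidType, V M -> V N -> V (prod_finMonoid M N).

Definition closed_under_submonoids (V : finMonoidClass) : Prop :=
  forall (M N : finMonoidType) (f : N -> M),
    monoid.monoid_morphism f -> injective f -> V M -> V N.

Definition closed_under_quotients (V : finMonoidClass) : Prop :=
  forall (M N : finMonoidType) (f : M -> N),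
    monoid.monoid_morphism f -> (forall y, exists x, f x = y) -> V M -> V N.

Definition variety (V : finMonoidClass) : Prop :=
  [/\ closed_under_products V, closed_under_submonoids V
    & closed_under_quotients V].

(* The smallest variety containing V and W, as the intersection of all of
   them. *)
Definition variety_join (V W : finMonoidClass) : finMonoidClass :=
  fun M => forall U : finMonoidClass, variety U ->
    (forall N, V N -> U N) -> (forall N, W N -> U N) -> U M.

Section IdempotentPower.
Variable M : finMonoidType.

Definition idempotent_exponent (k : nat) : bool :=
  (0 < k)%N && [forall x : M, (x ^+ k == x ^+ (2 * k))%g].

Lemma idempotent_exponent_exists : exists k, idempotent_exponent k.
Proof.
have fact_pos : (0 < factorial #|{: M}|)%N by exact: fact_gt0.
exists (factorial #|{: M}|); apply/andP; split=> //; apply/forallP=> x.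
have /injectivePn [i [j neq_ij eq_ij]] :
    ~~ injectiveb (fun i : 'I_#|{: M}|.+1 => (x ^+ i)%g).
  by apply/negP=> /injectiveP /leq_card; rewrite card_ord ltnn.
wlog lt_ij : i j neq_ij eq_ij / (i < j)%N => [IH|].
  case: (ltngtP i j) => [|lt_ji|/val_inj eqv]; first exact: IH.
    by apply: (IH j i) => //; rewrite eq_sym.
  by rewrite eqv eqxx in neq_ij.
have per m : (i <= m)%N -> (x ^+ (m + (j - i)) = x ^+ m)%g.
  move=> le_im; have -> : (m + (j - i) = m - i + j)%N.
    by rewrite addnBA ?(ltnW lt_ij) // addnC -addnBA // addnC.
  by rewrite expgnDr -eq_ij -expgnDr subnK.
have perk m k : (i <= m)%N -> (x ^+ (m + k * (j - i)) = x ^+ m)%g.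
  move=> le_im; elim: k => [|k IHk]; first by rewrite addn0.
  rewrite mulSn [(j - i + _)%N]addnC addnA per //.
  by rewrite (leq_trans le_im) ?leq_addr.
have le_jM : (j <= #|{: M}|)%N by rewrite -ltnS.
have dvd : (j - i %| factorial #|{: M}|)%N.
  by apply: dvdn_fact; rewrite subn_gt0 lt_ij (leq_trans (leq_subr _ _)).
have le_i : (i <= factorial #|{: M}|)%N.
  apply: leq_trans (ltnW lt_ij) (leq_trans le_jM _).
  apply: dvdn_leq => //; apply: dvdn_fact; rewrite leqnn andbT.
  exact: leq_trans (leq_ltn_trans (leq0n _) lt_ij) le_jM.
by rewrite mul2n -addnn -{3}(divnK dvd) perk.
Qed.

Definition idempotent_power : nat := ex_minn idempotent_exponent_exists.

End IdempotentPower.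

Definition Com : finMonoidClass :=
  fun M => forall x y : M, (x * y = y * x)%g.

Definition FL : finMonoidClass :=
  fun M => let w := idempotent_power M in
  forall x y z s t : M,
    ((x * y) ^+ w * s * t * (x * z) ^+ w
     = (x * y) ^+ w * s * x * t * (x * z) ^+ w)%g.

(* Positions are numbered from 0, so a word of length n over M is a function
   on 'I_n.  The third component n of each stream triple is a parameter, as an
   algorithm has a separate set of states for every length; length 0, which
   the problem excludes, is ignored by [correct] and [uses_space]. *)
Definition stream (M : finMonoidType) (n : nat) (w : 'I_n -> M)
    (pi : {perm 'I_n}) : seq (M * 'I_n) :=
  [seq (w (pi i), pi i) | i <- enum 'I_n].

Record algorithm (M : finMonoidType) := Algorithm {
  state : nat -> finType;
  initial : forall n, state n;
  update : forall n, state n -> M -> 'I_n -> state n;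
  output : forall n, state n -> M
}.

Definition run (M : finMonoidType) (A : algorithm M) (n : nat)
    (s : seq (M * 'I_n)) : state A n :=
  foldl (fun q e => update q e.1 e.2) (initial A n) s.

Definition correct (M : finMonoidType) (A : algorithm M) : Prop :=
  forall (n : nat) (w : 'I_n -> M) (pi : {perm 'I_n}), (0 < n)%N ->
    output (run A (stream w pi)) = (\prod_(i < n) w i)%g.

Definition uses_space (M : finMonoidType) (A : algorithm M) (s : nat -> nat) :
    Prop :=
  forall n, (0 < n)%N -> (#|state A n| <= 2 ^ s n)%N.

Local Open Scope classical_set_scope.
Local Open Scope ring_scope.

Definition space_bigO (R : realType) (M : finMonoidType) (g : nat -> R) :
    Prop :=
  exists (A : algorithm M) (s : nat -> nat),
    [/\ correct A, uses_space A s & (fun n => (s n)%:R : R) =O_\oo g].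

(* Omega in the sense of Hardy and Littlewood, not Knuth's (landau.v's
   'Omega_F). *)
Definition HL_Omega (R : realType) (f g : nat -> R) : Prop :=
  (0 < limn_esup (fun n => (f n / g n)%:E))%E.

Definition space_bigOmega (R : realType) (M : finMonoidType) (g : nat -> R) :
    Prop :=
  forall (A : algorithm M) (s : nat -> nat),
    correct A -> uses_space A s -> HL_Omega (fun n => (s n)%:R) g.

Definition space_bigTheta (R : realType) (M : finMonoidType) (g : nat -> R) :
    Prop :=
  space_bigO M g /\ space_bigOmega M g.

(* Main.v *)
Require Import Defs.
From HB Require Import structures.
From mathcomp Require Import all_boot all_order all_algebra all_fingroup.
From mathcomp Require Import all_classical all_reals all_analysis.
From mathcomp Require Import zify.

Set Implicit Arguments.
Unset Strict Implicit.
Unset Printing Implicit Defensive.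

Import Order.TTheory GRing.Theory Num.Theory.
Import numFieldNormedType.Exports.

(* FL v Com is defined by the single identity
     (xy)^w s x t (xz)^w = (xy)^w s t x (xz)^w,
   i.e. x may be moved freely between (xy)^w and (xz)^w.

   If it fails, an algorithm has to remember, for each of m blocks, whether x
   comes first or second around a gap that is filled later: filling the gaps
   turns one chosen block into s x t or s t x, and all blocks before and after
   it into (xy)^w and (xz)^w. So 2^m states are needed at length 5m.

   If it holds, call an occurrence of a letter a in a word middle when it has
   N > |M| occurrences of a on either side. By pigeonhole the two sides contain
   factors (ay)^w and (az)^w, so middle occurrences can be moved together, and
   the product is determined by the word without its middle letters and by the
   number of occurrences of each letter modulo w. The former lives in a monoid
   of FL, the latter in a commutative one.

   The monoids with polynomially many states at each length form a variety. It
   contains Com, and it contains FL because there middle letters can be dropped,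
   which leaves boundedly many (position, letter) pairs to remember. *)

(** * Deleting middle letters *)

Section Words.
Variables (A : eqType) (N : nat).
Implicit Types (B : pred A) (a b x y : A) (p u v w : seq A).

Definition middle p w a := (N <= count_mem a p) && (N <= count_mem a w).

(* p is the prefix already read, in reverse order. *)
Fixpoint trim B p w :=
  if w is x :: w' then
    if B x && middle p w' x then trim B (x :: p) w' else x :: trim B (x :: p) w'
  else [::].

Definition same_count p q := forall a, minn N (count_mem a p) = minn N (count_mem a q).

Lemma trim_ext B p q w :
  (forall a, B a -> minn N (count_mem a p) = minn N (count_mem a q)) ->
  trim B p w = trim B q w.
Proof.
elim: w p q => //= x w IH p q pq.
rewrite (IH _ (x :: q)); last first.
  by move=> a Ba /=; have := pq a Ba; lia.
rewrite /middle; case Bx: (B x) => //=; have := pq x Bx => e.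
by have -> : (N <= count_mem x p) = (N <= count_mem x q) by lia.
Qed.

(** The last [N] occurrences of a letter are never middle, so they survive. *)
Lemma count_trim B p w a :
  minn N (count_mem a (trim B p w)) = minn N (count_mem a w).
Proof.
elim: w p => //= x w IH p; have := IH (x :: p).
case: ifP => [/and3P[_ _ h]|_] /=; last lia.
by case: eqP h => [->|_]; lia.
Qed.

(** The survivors are the last [N] occurrences and those with fewer than [N] copies of [a] before
    them, of which [p] leaves [N - count_mem a p]. *)
Lemma count_trim_in B p w a : B a ->
  count_mem a (trim B p w) = minn (count_mem a w) (N - count_mem a p + N).
Proof.
move=> Ba; elim: w p => [|x w IH] p /=; first by rewrite min0n.
have := IH (x :: p); rewrite /middle /=; case: (eqVneq x a) => [->|xa].
  by rewrite Ba /=; case: ifP => /=; rewrite ?eqxx; lia.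
by case: ifP => _ /=; rewrite ?(negPf xa); lia.
Qed.

Lemma count_trim_out B p w a : ~~ B a ->
  count_mem a (trim B p w) = count_mem a w.
Proof.
move=> Ba; elim: w p => //= x w IH p; rewrite -(IH (x :: p)).
by case: ifP => //= /andP[Bx _]; case: eqP Ba => // <-; rewrite Bx.
Qed.

(** The inner pass keeps capped counts on the right, and drops a letter only when [N] copies stand
    to its left, so [same_count] persists although [p] does not receive that letter. Letters can
    thus be trimmed one at a time. *)
Lemma trim_trim B B' p q w : same_count p q ->
  trim B p (trim B' q w) = trim (predU B B') q w.
Proof.
elim: w p q => //= x w IH p q pq; have px := pq x.
case B'x: (B' x) => /=; last first.
  rewrite orbF /middle (_ : (N <= count_mem x (trim B' (x :: q) w))
                          = (N <= count_mem x w)); last first.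
    by have := count_trim B' (x :: q) w x; lia.
  have -> : (N <= count_mem x p) = (N <= count_mem x q) by lia.
  by rewrite (IH _ (x :: q)) // => a; have := pq a => /=; lia.
rewrite orbT /=; case: ifP => [/andP[h1 h2]|h] /=.
  by apply: IH => a /=; case: eqP => [<-|_]; have := pq a => /=; lia.
rewrite /middle (_ : (N <= count_mem x (trim B' (x :: q) w))
                     = (N <= count_mem x w)); last first.
  by have := count_trim B' (x :: q) w x; lia.
have -> : (N <= count_mem x p) = (N <= count_mem x q) by lia.
rewrite -/(middle q w x) h andbF.
by rewrite (IH _ (x :: q)) // => a; have := pq a => /=; lia.
Qed.

Lemma trim_catl B p q u v : same_count p q ->
  trim B p (trim B q u ++ v) = trim B q (u ++ v).
Proof.
elim: u p q => [|x u IH] p q pq /=; first by apply: trim_ext => a _.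
have px := pq x; have cu := count_trim B (x :: q) u x.
have spq : same_count (x :: p) (x :: q) by move=> a /=; have := pq a; lia.
rewrite [in RHS]/middle count_cat.
case: ifP => [/and3P[-> h1 h2]|h] /=.
  have -> : (N <= count_mem x u + count_mem x v) by lia.
  by rewrite h1 /=; apply: IH => a /=; case: eqP => [<-|_]; have := pq a; lia.
rewrite /middle count_cat (_ : (N <= count_mem x p) = (N <= count_mem x q)); last lia.
rewrite (_ : (N <= count_mem x (trim B (x :: q) u) + _)
             = (N <= count_mem x u + count_mem x v)); last lia.
by rewrite (IH _ (x :: q)).
Qed.

(** The inner pass sees a poorer left context [q] than the true one [r], so whatever it deletes is
    middle for [r] as well. *)
Lemma trim_idr B p q r v : same_count p r ->
  (forall a, minn N (count_mem a q) <= count_mem a r) ->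
  trim B p (trim B q v) = trim B r v.
Proof.
elim: v p q r => //= x v IH p q r pr qr; have px := pr x; have qx := qr x.
have cv := count_trim B (x :: q) v x.
have sqr a : minn N (count_mem a (x :: q)) <= count_mem a (x :: r).
  by move=> /=; have := qr a; lia.
case: ifP => [/and3P[-> h1 h2]|h] /=.
  rewrite /middle h2 andbT; have -> /= : N <= count_mem x r by lia.
  by apply: IH => // a /=; case: eqP => [<-|_]; have := pr a; lia.
rewrite /middle (_ : (N <= count_mem x p) = (N <= count_mem x r)); last lia.
rewrite (_ : (N <= count_mem x (trim _ _ _)) = (N <= count_mem x v)); last lia.
by rewrite (IH _ _ (x :: r)) // => a /=; have := pr a; lia.
Qed.

Lemma trim_catr B p u v : trim B p (u ++ trim B [::] v) = trim B p (u ++ v).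
Proof.
elim: u p => [|x u IH] p /=; first by apply: trim_idr => // a /=; lia.
have cv := count_trim B [::] v x.
rewrite IH /middle !count_cat.
by rewrite (_ : (N <= _ + count_mem x (trim _ _ _))
                = (N <= count_mem x u + count_mem x v)) //; lia.
Qed.

(** Among the letters of [u], only copies of [a] see a smaller count to their right, and [v] alone
    still supplies [N]; for the letters of [v], the left count of [a] has already reached the
    cap. *)
Lemma trim_delete B p a u v : B a -> N <= count_mem a p + count_mem a u ->
  N <= count_mem a v -> trim B p (u ++ a :: v) = trim B p (u ++ v).
Proof.
move=> Ba; elim: u p => [|y u IH] p /= pu va.
  rewrite addn0 in pu; rewrite Ba /middle pu va /=; apply: trim_ext => b _ /=.
  by case: eqP => [<-|_]; lia.
rewrite IH //=; last lia.
rewrite /middle !count_cat /= (_ : (N <= count_mem y u + (_ + _))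
                                   = (N <= count_mem y u + count_mem y v)) //.
by case: eqP va => [->|_]; lia.
Qed.

Lemma trim_delete_word B p s u v : (forall a, a \in s -> B a) ->
  (forall a, a \in s -> N <= count_mem a p + count_mem a u) ->
  (forall a, a \in s -> N <= count_mem a v) ->
  trim B p (u ++ s ++ v) = trim B p (u ++ v).
Proof.
elim: s => //= a s IH hB hu hv; rewrite trim_delete ?IH //.
- by move=> b bs; apply: hB; rewrite inE bs orbT.
- by move=> b bs; apply: hu; rewrite inE bs orbT.
- by move=> b bs; apply: hv; rewrite inE bs orbT.
- by apply: hB; rewrite mem_head.
- by apply: hu; rewrite mem_head.
- by rewrite count_cat (leq_trans (hv a (mem_head _ _))) ?leq_addl.
Qed.

Lemma trim_small B p w :
  (forall a, B a -> minn N (count_mem a p) + count_mem a w <= N + N) ->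
  trim B p w = w.
Proof.
elim: w p => //= x w IH p h; rewrite IH => [|a /h /=]; last lia.
rewrite /middle; case Bx: (B x) => //=; have := h x Bx.
by rewrite /= eqxx; case: ifP => //; lia.
Qed.

Lemma trim_pred0 B p w : B =1 pred0 -> trim B p w = w.
Proof. by move=> B0; apply: trim_small => a; rewrite B0. Qed.

Lemma eq_trim B B' p w : B =1 B' -> trim B p w = trim B' p w.
Proof. by move=> BB'; elim: w p => //= x w IH p; rewrite BB' IH. Qed.

Lemma trim_cat_small B p u v :
  (forall a, B a -> count_mem a p + count_mem a u <= N) ->
  exists q, (forall a, count_mem a q = count_mem a p + count_mem a u) /\
  trim B p (u ++ v) = u ++ trim B q v.
Proof.
elim: u p => /= [|x u IH] p h.
  by exists p; split=> // a; rewrite addn0.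
have [a /=|q [cq ->]] := IH (x :: p); first by move=> /h; lia.
exists q; split=> [a|]; first by rewrite cq /=; lia.
case: ifP => // /and3P[Bx h1 _].
by have := h x Bx; rewrite /= eqxx; lia.
Qed.

(* Inserts z just before the occurrence number n (counted from 0) of a. *)
Fixpoint ins a z n w :=
  if w is x :: w' then
    if x == a then
      if n is n'.+1 then x :: ins a z n' w' else z ++ w
    else x :: ins a z n w'
  else [::].

Lemma count_ins a k n w b :
  b != a -> count_mem b (ins a (nseq k a) n w) = count_mem b w.
Proof.
move=> ba; elim: w n => //= x w IH n; case: eqP => [->|_] /=; last by rewrite IH.
case: n => [|n] /=; last by rewrite IH.
by rewrite count_cat count_nseq /= eq_sym (negPf ba).
Qed.

(** As [a] is outside [B], the inserted copies are kept and alter no count that the trimming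
    consults. *)
Lemma trim_ins B p a k n w : ~~ B a ->
  trim B p (ins a (nseq k a) n w) = ins a (nseq k a) n (trim B p w).
Proof.
move=> Ba; elim: w p n => //= x w IH p n; case: eqP => [->|/eqP xa].
  rewrite (negPf Ba) /= eqxx; case: n => [|n] /=; last by rewrite (negPf Ba) /= IH.
  elim: {IH} k p => [|k IHk] p /=; rewrite (negPf Ba) //=.
  rewrite IHk; congr (_ :: (_ ++ _ :: _)); apply: trim_ext => b Bb /=.
  by case: eqP Bb => [<-|]; rewrite ?(negPf Ba).
rewrite /= /middle count_ins // -/(middle p w x).
by case: ifP => //= _; rewrite IH // (negPf xa).
Qed.

Lemma ins_cat a z n u v : ins a z (count_mem a u + n) (u ++ v) = u ++ ins a z n v.
Proof.
elim: u => //= x u IH; case: eqP => [->|_] /=; first by rewrite -IH.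
by rewrite add0n IH.
Qed.

Lemma ins0 a z w : a \in w -> exists u v,
  w = u ++ a :: v /\ ins a z 0 w = u ++ z ++ a :: v /\ a \notin u.
Proof.
elim: w => //= x w IH; rewrite inE eq_sym; case: eqP => [->|/eqP xa] /=.
  by exists [::], w.
by move=> /IH [u [v [-> [-> au]]]]; exists (x :: u), v; rewrite inE eq_sym negb_or xa.
Qed.

Lemma split_count a n w : n <= count_mem a w ->
  exists u v, w = u ++ v /\ count_mem a u = n.
Proof.
elim: w n => [|x w IH] [|n] //=; first by exists [::], [::].
  by exists [::], (x :: w).
case: eqP => [->|/eqP xa] /=.
  by rewrite add1n ltnS => /IH [u [v [-> <-]]]; exists (a :: u), v; rewrite /= eqxx.
by rewrite add0n => /IH [u [v [-> <-]]]; exists (x :: u), v; rewrite /= (negPf xa).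
Qed.

End Words.

Lemma size_trim (A : finType) N p (w : seq A) :
  size (trim N predT p w) <= #|A| * (N + N).
Proof.
have -> : size (trim N predT p w) = \sum_(a : A) count_mem a (trim N predT p w).
  rewrite -sum1_size (partition_big id predT) //=; apply: eq_bigr => a _.
  by rewrite sum1_count.
apply: leq_trans (_ : \sum_(a : A) (N + N) <= _); last by rewrite sum_nat_const.
by apply: leq_sum => a _; rewrite count_trim_in //; lia.
Qed.

(** * The identity of FL v Com *)

Section Monoid.
Variable M : finMonoidType.
Implicit Types (x y z s t a c g h : M) (p u v : seq M).
Local Open Scope group_scope.

Local Notation w := (idempotent_power M).
Local Notation P u := (\prod_(x <- u) x).

Lemma idempotent_powerP : idempotent_exponent M w.
Proof. by rewrite /idempotent_power; case: ex_minnP. Qed.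

Lemma idempotent_power_gt0 : (0 < w)%N.
Proof. by have /andP[] := idempotent_powerP. Qed.

Lemma expg_idempotent x : x ^+ w * x ^+ w = x ^+ w.
Proof.
have /andP[_ /forallP/(_ x)/eqP {3}->] := idempotent_powerP.
by rewrite mul2n -addnn expgnDr.
Qed.

Lemma expg_mul_idempotent x k : (0 < k)%N -> x ^+ (k * w) = x ^+ w.
Proof.
case: k => // k _; elim: k => [|k IH]; first by rewrite mul1n.
by rewrite mulSn expgnDr IH expg_idempotent.
Qed.

Lemma fixed_expg c g k : c = c * g -> c = c * g ^+ k.
Proof.
by move=> e; elim: k => [|k IH]; rewrite ?mulg1 // expgSr mulgA -IH.
Qed.

(* Pigeonhole: among the prefixes ending just before an occurrence of a, two
   have the same value c, so that c = c a y = c (a y)^w. *)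
Lemma factor_from c u (V : {set M}) a :
  (forall d, d \in V -> exists y, c = d * (a * y)) ->
  (#|{: M}| < count_mem a u + #|V|)%N ->
  exists g y h, c * P u = g * (a * y) ^+ w * h.
Proof.
elim: u c V => [|x u IH] c V hV; first by rewrite add0n ltnNge max_card.
(* [V] records the values in front of earlier occurrences of [a], each of which leads to [c] through
   that [a]. Either [c] is among them, or [V] grows. *)
have [xa|xa] := eqVneq x a.
  rewrite xa /= eqxx; case cV: (c \in V).
    have [y e] := hV c cV => _.
    by exists c, y, (P (a :: u)); rewrite -fixed_expg.
  move=> lt; rewrite big_cons mulgA; apply: (IH _ (c |: V)) => [d|].
    rewrite in_setU1 => /predU1P[->|/hV [y ->]]; first by exists 1; rewrite mulg1.
    by exists (y * a); rewrite !mulgA.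
  by rewrite cardsU1 cV /=; lia.
rewrite /= (negPf xa) add0n big_cons mulgA => lt; apply: IH lt => d /hV [y ->].
by exists (y * x); rewrite !mulgA.
Qed.

Lemma factor a u : (#|{: M}| < count_mem a u)%N ->
  exists g y h, P u = g * (a * y) ^+ w * h.
Proof.
move=> lt; case: (@factor_from 1 u finset.set0 a) => [d| |g].
- by rewrite inE.
- by rewrite cards0 addn0.
- by rewrite mul1g; exists g.
Qed.

Definition moves : Prop := forall x y z s t,
  (x * y) ^+ w * s * x * t * (x * z) ^+ w = (x * y) ^+ w * s * t * x * (x * z) ^+ w.

(** The two sides supply factors [(a * y) ^+ w] and [(a * z) ^+ w], between which the identity of
    [FL] erases [a]. *)
Lemma FL_delete a u v : FL M ->
  (#|{: M}| < count_mem a u)%N -> (#|{: M}| < count_mem a v)%N ->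
  P (u ++ a :: v) = P (u ++ v).
Proof.
move=> fl /factor [g [y [h eu]]] /factor [g' [z [h' ev]]].
rewrite !big_cat big_cons /= eu ev.
have /(congr1 (fun r => g * r * h')) := fl a y z h g'.
by rewrite !mulgA => <-.
Qed.

Section Moves.
Hypothesis mv : moves.

Lemma moves_expg x y z s t k :
  (x * y) ^+ w * s * x ^+ k * t * (x * z) ^+ w
  = (x * y) ^+ w * s * t * x ^+ k * (x * z) ^+ w.
Proof.
elim: k s t => [|k IH] s t; first by rewrite !mulg1.
have := IH (s * x) t; have := mv x y z s (t * x ^+ k).
by rewrite !expgS !mulgA => -> ->; have := IH (s * t) x; rewrite !mulgA.
Qed.

Lemma moves_collect x y z s t k :
  (x * y) ^+ w * s * (x * y) ^+ k * t * (x * z) ^+ w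
  = (x * y) ^+ w * s * y ^+ k * t * x ^+ k * (x * z) ^+ w.
Proof.
elim: k s t => [|k IH] s t; first by rewrite !mulg1.
have := mv x y z s (y * (x * y) ^+ k * t); have := IH (s * y) (t * x).
rewrite (expgS (x * y)) (expgS y) (expgS x) !mulgA => e1 ->.
by rewrite e1.
Qed.

(** Doubling the idempotent [(x * y) ^+ w] and collecting the [x]s of one copy creates [x ^+ w] on
    the right. The right-hand side yields the same element, as [x ^+ w] is idempotent. *)
Lemma moves_insert x y z s :
  (x * y) ^+ w * s * (x * z) ^+ w = (x * y) ^+ w * s * x ^+ w * (x * z) ^+ w.
Proof.
have := moves_collect x y z 1 s w; rewrite !mulg1 expg_idempotent => e1.
have := moves_collect x y z 1 (s * x ^+ w) w.
rewrite !mulg1 expg_idempotent !mulgA => ->.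
by rewrite e1 -[in RHS](mulgA _ (x ^+ w) (x ^+ w)) expg_idempotent.
Qed.

Variables (N : nat) (a : M).
Hypothesis ltMN : (#|{: M}| < N)%N.

Lemma moves_word k u1 u2 v :
  (N <= count_mem a u1)%N -> (N <= count_mem a v)%N ->
  P (u1 ++ u2 ++ nseq k a ++ v) = P (u1 ++ nseq k a ++ u2 ++ v).
Proof.
move=> /(leq_trans ltMN)/factor [g [y [h eu]]].
move=> /(leq_trans ltMN)/factor [g' [z [h' ev]]].
rewrite !big_cat /= big_nseq iter_mulg_1 eu ev.
have := moves_expg a y z (h * P u2) g' k; have := moves_expg a y z h (P u2 * g') k.
rewrite !mulgA => <- /(congr1 (fun r => g * r * h')).
by rewrite !mulgA.
Qed.

Lemma moves_word_insert k u v :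
  (N <= count_mem a u)%N -> (N <= count_mem a v)%N ->
  P (u ++ nseq (k * w) a ++ v) = P (u ++ v).
Proof.
case: k => // k /(leq_trans ltMN)/factor [g [y [h eu]]].
move=> /(leq_trans ltMN)/factor [g' [z [h' ev]]].
rewrite !big_cat /= big_nseq iter_mulg_1 expg_mul_idempotent // eu ev.
have := moves_expg a y z h g' w; have := moves_insert a y z (h * g').
rewrite !mulgA => <- /(congr1 (fun r => g * r * h')).
by rewrite !mulgA.
Qed.

(** [ins] stops at the first [a] of [v], so the part passed over contains no [a] and the [N] copies
    needed on the right still lie beyond it. *)
Lemma prod_ins0 k u v : (N <= count_mem a u)%N -> (N <= count_mem a v)%N ->
  P (u ++ ins a (nseq k a) 0 v) = P (u ++ nseq k a ++ v).
Proof.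
move=> cu cv; have av : a \in v by rewrite -has_pred1 has_count; lia.
have [v1 [v2 [ev [-> av1]]]] := ins0 (nseq k a) av.
rewrite moves_word // -?ev //; move: cv; rewrite ev count_cat.
by rewrite (count_memPn av1).
Qed.

(** The deleted copies of [a] form a block in front of the trimmed word. As letters pass from [v] to
    [u], the block gives up each deleted [a] and crosses the other letters by [moves_word]. *)
Lemma prod_trim1 p u v : (N <= count_mem a p)%N -> (N <= count_mem a u)%N ->
  (N <= count_mem a v)%N ->
  P (u ++ nseq (count_mem a v - N) a ++ trim N (pred1 a) p v) = P (u ++ v).
Proof.
elim: v p u => // x v IH p u; rewrite /= => cp cu.
have [->|xa] := eqVneq x a.
  rewrite /middle cp /=.
  case: (leqP N (count_mem a v)) => cv _.
    rewrite add1n subSn //= -cat_rcons -[in RHS]cat_rcons IH //=; first lia.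
    by rewrite -cats1 count_cat (leq_trans cu) ?leq_addr.
  (* At most [N] copies of [a] are left, so nothing more is deleted and the block is empty. *)
  rewrite trim_small => [|b /eqP -> /=]; last first.
    exact: leq_add (geq_minl _ _) (ltnW cv).
  by have -> : (1 + count_mem a v - N = 0)%N by lia.
rewrite add0n /= => cv.
have := count_trim N (pred1 a) (x :: p) v a; rewrite /= => ct.
rewrite -(@moves_word _ _ [:: x]) //=; last lia.
rewrite -cat_rcons IH /= ?cat_rcons //; first lia.
by rewrite -cats1 count_cat; lia.
Qed.

Lemma prod_nseq_mod k u v : (N <= count_mem a u)%N -> (N <= count_mem a v)%N ->
  P (u ++ nseq k a ++ v) = P (u ++ nseq (k %% w) a ++ v).
Proof.
move=> cu cv; rewrite [in LHS](divn_eq k w) addnC nseqD -catA catA.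
by rewrite moves_word_insert -?catA // count_cat (leq_trans cu) ?leq_addr.
Qed.

(** This undoes the trimming of [a] up to multiples of [w]: the lost copies return right before
    occurrence number [N], where [N] copies precede and [N] follow. *)
Lemma prod_ins_trim u : (N + N <= count_mem a u)%N ->
  P (ins a (nseq ((count_mem a u - (N + N)) %% w) a) N (trim N (pred1 a) [::] u))
  = P u.
Proof.
move=> cu; have [|u1 [u2 [eu cu1]]] := @split_count _ a N u; first lia.
have [|q [cq eq]] := @trim_cat_small _ N (pred1 a) [::] u1 u2.
  by move=> b /eqP ->; rewrite cu1.
have cu2 : (N <= count_mem a u2)%N by move: cu; rewrite eu count_cat; lia.
have ct := count_trim N (pred1 a) q u2 a.
have cqa : count_mem a q = N by rewrite cq cu1.
(* [N] is written as [count_mem a u1 + 0], so that [ins_cat] carries the insertion past [u1]. *)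
rewrite [in trim _ _ _ u]eu eq -[X in ins _ _ X]addn0 -[X in ins _ _ (X + _)]cu1.
rewrite ins_cat prod_ins0 ?cu1 //; last lia.
rewrite -prod_nseq_mod ?cu1 //; last lia.
have -> : (count_mem a u - (N + N) = count_mem a u2 - N)%N.
  by rewrite eu count_cat; lia.
by rewrite prod_trim1 ?cqa ?cu1 // eu.
Qed.

End Moves.

(* Letter by letter: the middle occurrences of a can be moved together and
   their number reduced modulo w; the two words then agree around a. *)
Lemma prod_trim_count N (L : seq M) u v : moves -> (#|{: M}| < N)%N -> uniq L ->
  trim N (mem L) [::] u = trim N (mem L) [::] v ->
  (forall a, a \in L -> count_mem a u = count_mem a v %[mod w]) -> P u = P v.
Proof.
move=> mv ltMN; elim: L u v => [|a L IH] u v /=.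
  by move=> _; rewrite !trim_pred0 // => ->.
move=> /andP[aL uL].
have tE (r : seq M) : trim N (mem (a :: L)) [::] r
    = trim N (mem L) [::] (trim N (pred1 a) [::] r).
  by rewrite trim_trim //; apply: eq_trim => b /=; rewrite inE orbC.
have ct (r : seq M) : count_mem a (trim N (mem (a :: L)) [::] r)
    = minn (count_mem a r) (N + N).
  by rewrite count_trim_in /= ?mem_head // subn0.
move=> e cuv; have := ct v; rewrite -e ct => ec.
rewrite !tE in e.
have cL b : b \in L -> count_mem b u = count_mem b v %[mod w].
  by move=> bL; apply: cuv; rewrite inE bL orbT.
(* With fewer than [N + N] copies of [a], trimming [a] changes neither word and the induction
   hypothesis applies directly. *)
case: (leqP (N + N) (count_mem a u)) => cu; last first.
  have cv : (count_mem a v < N + N)%N by lia.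
  have ts (r : seq M) : (count_mem a r < N + N)%N -> trim N (pred1 a) [::] r = r.
    by move=> cr; apply: trim_small => b /eqP ->; rewrite minn0 ltnW.
  by apply: IH; rewrite // -(ts u) // -(ts v).
have cv : (N + N <= count_mem a v)%N by lia.
rewrite -(prod_ins_trim mv ltMN cu) -(prod_ins_trim mv ltMN cv).
have -> : (count_mem a u - (N + N)) %% w = (count_mem a v - (N + N)) %% w.
  by apply/eqP; rewrite -(eqn_modDr (N + N)) !subnK //; apply/eqP/cuv/mem_head.
(* Both words now carry the same residue of copies of [a], and trimming the letters of [L] commutes
   with that insertion since [a] is not in [L]. *)
apply: IH => //; first by rewrite !trim_ins // e.
move=> b bL; have ba : b != a by apply: contraNneq aL => <-.
by rewrite !count_ins // !count_trim_out //= ?cL.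
Qed.
End Monoid.

(** * Finite quotients of free monoids *)

Section WordQuotient.
Variables (A : Type) (T : finType) (h : seq A -> T).
Hypothesis hcat : forall u u' v v', h u = h u' -> h v = h v' ->
  h (u ++ v) = h (u' ++ v').

(** The classes of words under the kernel of [h] are represented by the values that [h] attains, so
    finiteness comes from [T]. *)
Definition word_classes : finType := {t : T | `[< exists u, h u = t >]}.

Lemma word_class_subproof u : `[< exists v, h v = h u >].
Proof. by apply/asboolP; exists u. Qed.

Definition word_class u : word_classes := exist _ (h u) (word_class_subproof u).

Definition word_repr (q : word_classes) : seq A :=
  projT1 (cid (asboolW (valP q))).

Lemma h_word_repr q : h (word_repr q) = val q.
Proof. by rewrite /word_repr; case: cid. Qed.

Lemma word_reprK : cancel word_repr word_class.
Proof. by move=> q; apply/val_inj; rewrite /= h_word_repr. Qed.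

Lemma word_class_eq u v : word_class u = word_class v <-> h u = h v.
Proof. by split=> [/(congr1 val)|e]; last apply/val_inj. Qed.

Lemma h_word_class u : h (word_repr (word_class u)) = h u.
Proof. by rewrite h_word_repr. Qed.

Definition word_mul q r := word_class (word_repr q ++ word_repr r).

Lemma word_mulE u v : word_mul (word_class u) (word_class v) = word_class (u ++ v).
Proof. by apply/word_class_eq/hcat; rewrite h_word_class. Qed.

Lemma word_mulA : associative word_mul.
Proof.
move=> q r s; rewrite -(word_reprK q) -(word_reprK r) -(word_reprK s).
by rewrite !word_mulE catA.
Qed.

Lemma word_mul1m : left_id (word_class [::]) word_mul.
Proof. by move=> q; rewrite -(word_reprK q) word_mulE. Qed.

Lemma word_mulm1 : right_id (word_class [::]) word_mul.
Proof. by move=> q; rewrite -(word_reprK q) word_mulE cats0. Qed.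

Definition word_quotient : finMonoidType :=
  FinMonoid word_mulA word_mul1m word_mulm1.

Definition quot_class (u : seq A) : word_quotient := word_class u.
Definition quot_repr (q : word_quotient) : seq A := word_repr q.

Lemma quot_reprK : cancel quot_repr quot_class. Proof. exact: word_reprK. Qed.

Lemma quot_class_eq u v : quot_class u = quot_class v <-> h u = h v.
Proof. exact: word_class_eq. Qed.

Lemma quot_class1 : quot_class [::] = 1%g. Proof. by []. Qed.

Lemma quot_classM u v : quot_class (u ++ v) = (quot_class u * quot_class v)%g.
Proof. exact: esym (word_mulE u v). Qed.

Lemma quot_classX u n :
  quot_class (flatten (nseq n u)) = (quot_class u ^+ n)%g.
Proof.
by elim: n => [|n IH] //=; rewrite quot_classM IH expgS.
Qed.

End WordQuotient.

Section TrimMonoid.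
Variables (A : finType) (N : nat).
Implicit Types u v : seq A.

Local Notation red := (trim N predT [::]).

Definition trim_code u : (#|{: A}| * (N + N)).-bseq A := Bseq (size_trim N [::] u).

Lemma trim_codeE u v : trim_code u = trim_code v <-> red u = red v.
Proof. by split=> [/(congr1 val)|e]; last apply/val_inj. Qed.

(** By [trim_catl] and [trim_catr], trimming a concatenation only needs the trimmed pieces. *)
Lemma trim_code_cat u u' v v' : trim_code u = trim_code u' ->
  trim_code v = trim_code v' -> trim_code (u ++ v) = trim_code (u' ++ v').
Proof.
move=> /trim_codeE eu /trim_codeE ev; apply/trim_codeE.
rewrite -(trim_catr _ _ _ u v) -(@trim_catl _ N _ [::]) // eu ev.
by rewrite trim_catl // trim_catr.
Qed.

Definition trim_monoid := word_quotient trim_code_cat.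

Lemma count_flatten_nseq n u a :
  count_mem a (flatten (nseq n u)) = (n * count_mem a u)%N.
Proof. by elim: n => //= n IH; rewrite count_cat IH mulSn. Qed.

Lemma trim_monoid_FL : FL trim_monoid.
Proof.
rewrite /FL; set w := idempotent_power _ => x y z s t.
(* The [w]-th power of [u] and its square have the same trimmed form, hence the same count of [a]
   capped at [N]; a positive number agreeing with its double under the cap is at least [N]. *)
have big u a : a \in u -> (N <= count_mem a (flatten (nseq w u)))%N.
  move=> au; have := expg_idempotent (quot_class trim_code_cat u).
  rewrite -quot_classX -quot_classM => /quot_class_eq/trim_codeE.
  move=> /(congr1 (fun v => minn N (count_mem a v))).
  rewrite !count_trim count_cat count_flatten_nseq.
  have : (0 < w * count_mem a u)%N.
    by rewrite muln_gt0 idempotent_power_gt0 -has_count has_pred1.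
  by rewrite -/w; lia.
rewrite -(quot_reprK x) -(quot_reprK y) -(quot_reprK z).
rewrite -(quot_reprK s) -(quot_reprK t).
move: (quot_repr x) (quot_repr y) (quot_repr z) => X Y Z.
move: (quot_repr s) (quot_repr t) => S T.
set p := flatten (nseq w (X ++ Y)); set q := flatten (nseq w (X ++ Z)).
have e : quot_class trim_code_cat (p ++ S ++ T ++ q)
    = quot_class trim_code_cat (p ++ S ++ X ++ T ++ q).
  apply/quot_class_eq/trim_codeE.
  rewrite [in RHS]catA [in RHS]trim_delete_word //= => [|a aX|a aX].
  - by rewrite -catA.
  - by rewrite count_cat (leq_trans (big (X ++ Y) a _)) ?leq_addr // mem_cat aX.
  - by rewrite count_cat (leq_trans (big (X ++ Z) a _)) ?leq_addl // mem_cat aX.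
by move: e; rewrite /p /q !(quot_classM, quot_classX) !mulgA.
Qed.

End TrimMonoid.

Section CountMonoid.
Variables (A : finType) (d : nat).
Hypothesis d_gt0 : (0 < d)%N.
Implicit Types u v : seq A.

(** Residues lie below [d]; the range ['I_d.+1] is a successor so that [inord] applies. *)
Definition count_code u : {ffun A -> 'I_d.+1} :=
  [ffun a => inord (count_mem a u %% d)].

Lemma count_codeE u v : count_code u = count_code v <->
  forall a, count_mem a u = count_mem a v %[mod d].
Proof.
split=> [e a|e]; last by apply/ffunP => a; rewrite !ffunE e.
move/ffunP/(_ a)/(congr1 val): e; rewrite !ffunE /= !inordK //.
  by rewrite ltnS ltnW // ltn_pmod.
by rewrite ltnS ltnW // ltn_pmod.
Qed.

Lemma count_code_cat u u' v v' : count_code u = count_code u' ->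
  count_code v = count_code v' -> count_code (u ++ v) = count_code (u' ++ v').
Proof.
move=> /count_codeE eu /count_codeE ev; apply/count_codeE => a.
by rewrite !count_cat -modnDm eu ev modnDm.
Qed.

Definition count_monoid := word_quotient count_code_cat.

Lemma count_monoid_Com : Com count_monoid.
Proof.
move=> x y; rewrite -(quot_reprK x) -(quot_reprK y) -!quot_classM.
by apply/quot_class_eq/count_codeE => a; rewrite !count_cat addnC.
Qed.

End CountMonoid.

(** Words modulo both their trimmed form and their letter counts form a monoid [S]. It embeds in [F]
    times [C], and it maps onto [M] because [prod_trim_count] recovers the product from these
    data. *)
Lemma moves_variety_join (M : finMonoidType) : moves M -> variety_join FL Com M.
Proof.
move=> mv U [Uprod Usub Uquo] UFL UCom.
pose N := #|{: M}|.+1; pose w := idempotent_power M.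
have w0 : (0 < w)%N by exact: idempotent_power_gt0.
pose F := trim_monoid M N; pose C := count_monoid M w0.
pose h (u : seq M) := (trim_code N u, count_code w u).
have hcat u u' v v' : h u = h u' -> h v = h v' -> h (u ++ v) = h (u' ++ v').
  move=> eu ev; congr pair.
    exact: trim_code_cat (congr1 fst eu) (congr1 fst ev).
  exact: (count_code_cat w0 (congr1 snd eu) (congr1 snd ev)).
pose S := word_quotient hcat.
have SE u v : quot_class hcat u = quot_class hcat v ->
    trim_code N u = trim_code N v /\ count_code w u = count_code w v.
  by move=> /quot_class_eq e; split; [exact: (congr1 fst e) | exact: (congr1 snd e)].
have US : U S.
  pose f (q : S) : prod_finMonoid F C :=
    (quot_class (@trim_code_cat M N) (quot_repr q),
     quot_class (@count_code_cat M w w0) (quot_repr q)).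
  have fE u : f (quot_class hcat u) = (quot_class (@trim_code_cat M N) u,
      quot_class (@count_code_cat M w w0) u).
    have [e1 e2] := SE _ _ (quot_reprK (quot_class hcat u)).
    by congr pair; apply/quot_class_eq.
  apply: (Usub (prod_finMonoid F C) S f).
  - split=> [|x y]; first by rewrite -(quot_class1 hcat) fE.
    rewrite -(quot_reprK x) -(quot_reprK y) -quot_classM !fE.
    by rewrite !quot_classM.
  - move=> x y; rewrite -(quot_reprK x) -(quot_reprK y) !fE => e.
    apply/quot_class_eq; congr pair.
      by apply/(quot_class_eq (@trim_code_cat M N)); exact: (congr1 fst e).
    by apply/(quot_class_eq (@count_code_cat M w w0)); exact: (congr1 snd e).
  - by apply: Uprod; [apply/UFL/trim_monoid_FL | apply/UCom/count_monoid_Com].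
pose g (q : S) : M := (\prod_(x <- quot_repr q) x)%g.
have gE u : g (quot_class hcat u) = (\prod_(x <- u) x)%g.
  have [e1 e2] := SE _ _ (quot_reprK (quot_class hcat u)).
  rewrite /g; apply: (@prod_trim_count M N (enum {: M}) _ u mv) => //.
  - exact: enum_uniq.
  - have eT : mem (enum {: M}) =1 predT by move=> x /=; rewrite mem_enum.
    by rewrite !(eq_trim _ _ _ eT); apply/trim_codeE.
  - by move=> a _; move/count_codeE: e2; apply.
apply: (Uquo S M g) => //.
- split=> [|x y]; first by rewrite -(quot_class1 hcat) gE big_nil.
  by rewrite -(quot_reprK x) -(quot_reprK y) -quot_classM !gE big_cat.
- by move=> x; exists (quot_class hcat [:: x]); rewrite gE big_seq1.
Qed.

(** * Logarithmic space *)

(** The base [n.+1] leaves room for several states even at [n = 1]. *)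
Definition poly_space (M : finMonoidType) : Prop :=
  exists (A : algorithm M) (c : nat),
    correct A /\ forall n, (0 < n)%N -> (#|state A n| <= n.+1 ^ c)%N.

Lemma Com_prod_perm (M : finMonoidType) (s t : seq M) : Com M -> perm_eq s t ->
  (\prod_(x <- s) x = \prod_(x <- t) x)%g.
Proof.
move=> cM st; pose P (r : seq M) := (\prod_(x <- s) x = \prod_(x <- r) x)%g.
apply: (catCA_perm_ind (P := P)) st _ => //; rewrite /P.
by move=> s1 s2 s3 ->; rewrite !big_cat /= !mulgA (cM (\prod_(x <- s1) x)%g).
Qed.

Lemma perm_map_enum n (pi : {perm 'I_n}) :
  perm_eq [seq pi i | i <- enum 'I_n] (enum 'I_n).
Proof.
apply: uniq_perm; rewrite ?enum_uniq ?(map_inj_uniq perm_inj) ?enum_uniq //.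
move=> i; rewrite mem_enum; apply/mapP; exists ((pi^-1)%g i); rewrite ?mem_enum //.
by rewrite permKV.
Qed.

Lemma stream_enum (M : finMonoidType) n (w : 'I_n -> M) (pi : {perm 'I_n}) :
  stream w pi = [seq (w i, i) | i <- [seq pi i | i <- enum 'I_n]].
Proof. by rewrite -[RHS]map_comp. Qed.

Definition Com_algorithm (M : finMonoidType) : algorithm M :=
  @Algorithm M (fun _ => fm_sort M : finType) (fun _ => 1%g : M)
    (fun n (q x : M) (i : 'I_n) => (q * x)%g) (fun n q => q).

Lemma Com_algorithm_correct (M : finMonoidType) : Com M -> correct (Com_algorithm M).
Proof.
move=> cM n w pi _.
have runE (q : M) (s : seq (M * 'I_n)) :
    foldl (fun q e => update (a := Com_algorithm M) q e.1 e.2) q s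
    = (q * \prod_(x <- [seq e.1 | e <- s]) x)%g.
  elim: s q => [|e s IH] q /=; first by rewrite big_nil mulg1.
  by rewrite IH big_cons mulgA.
rewrite /run /= runE mul1g /stream -map_comp.
have -> : (\prod_(i < n) w i = \prod_(i <- enum 'I_n) w i)%g by rewrite enumT unlock.
rewrite -[RHS](big_map w predT id); apply: Com_prod_perm => //.
by rewrite (map_comp w pi); apply/perm_map/perm_map_enum.
Qed.

Lemma Com_poly_space (M : finMonoidType) : Com M -> poly_space M.
Proof.
move=> cM; exists (Com_algorithm M), #|{: M}|; split.
  exact: Com_algorithm_correct.
move=> n n0; apply: (leq_trans (ltnW (@ltn_expl 2 #|{: M}| isT))).
by rewrite leq_exp2r // ?ltnS //; apply/card_gt0P; exists (1%g : M).
Qed.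

Lemma stream_map (M N : finMonoidType) n (f : M -> N) (w : 'I_n -> M) pi :
  stream (f \o w) pi = [seq (f e.1, e.2) | e <- stream w pi].
Proof. by rewrite /stream -[RHS]map_comp. Qed.

Lemma prod_morph (M N : finMonoidType) n (f : M -> N) (w : 'I_n -> M) :
  monoid.monoid_morphism f ->
  f (\prod_(i < n) w i)%g = (\prod_(i < n) f (w i))%g.
Proof. by move=> [f1 fM]; apply: big_morph. Qed.

Lemma foldl_map (S T U : Type) (f : U -> T -> U) (g : S -> T) q (s : seq S) :
  foldl f q [seq g x | x <- s] = foldl (fun r x => f r (g x)) q s.
Proof. by elim: s q => /=. Qed.

(** For a product both algorithms run side by side and the exponents add. For a sub-monoid or a
    quotient, each letter is translated into the larger monoid and the output is translated back. *)
Lemma poly_space_variety : variety poly_space.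
Proof.
split.
- move=> M N [A [c [cA sA]]] [B [d [cB sB]]].
  pose AB := @Algorithm (prod_finMonoid M N)
    (fun n => (state A n * state B n)%type) (fun n => (initial A n, initial B n))
    (fun n q x i => (update q.1 x.1 i, update q.2 x.2 i))
    (fun n q => (output q.1, output q.2)).
  exists AB, (c + d)%N; split=> [n w pi n0|n n0]; last first.
    by rewrite card_prod expnD leq_mul ?sA ?sB.
  have runE (s : seq (prod_finMonoid M N * 'I_n)) :
      run AB s = (run A [seq (e.1.1, e.2) | e <- s], run B [seq (e.1.2, e.2) | e <- s]).
    by rewrite /run /=; elim: s (initial A n) (initial B n) => //=.
  have m1 : monoid.monoid_morphism (fst : prod_finMonoid M N -> M) by [].
  have m2 : monoid.monoid_morphism (snd : prod_finMonoid M N -> N) by [].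
  rewrite runE /= -(stream_map (fst : prod_finMonoid M N -> M)).
  rewrite -(stream_map (snd : prod_finMonoid M N -> N)) cA // cB //.
  by rewrite [RHS]surjective_pairing (prod_morph w m1) (prod_morph w m2).
- move=> M N f fM finj [A [c [cA sA]]].
  (* On the states reached by a stream the output lies in the image of [f], so [pick] succeeds
     there; the default [1] only makes [output] total. *)
  pose B := @Algorithm N (state A) (initial A) (fun n q x i => update q (f x) i)
    (fun n q => odflt 1%g [pick y | f y == output q]).
  exists B, c; split=> // n w pi n0.
  have -> : run B (stream w pi) = run A (stream (f \o w) pi).
    by rewrite stream_map /run /= foldl_map.
  rewrite /= cA // -(prod_morph w fM).
  by case: pickP => [y /eqP/finj|/(_ (\prod_(i < n) w i)%g)]; rewrite ?eqxx.
- move=> M N f fM fsurj [A [c [cA sA]]].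
  have [g gK] : exists g : N -> M, cancel g f.
    by exists (fun y => projT1 (cid (fsurj y))) => y; case: cid.
  pose B := @Algorithm N (state A) (initial A) (fun n q x i => update q (g x) i)
    (fun n q => f (output q)).
  exists B, c; split=> // n w pi n0.
  have -> : run B (stream w pi) = run A (stream (g \o w) pi).
    by rewrite stream_map /run /= foldl_map.
  rewrite /= cA // (prod_morph _ fM).
  by apply: eq_bigr => i _; rewrite /= gK.
Qed.

(** * A sparse-memory algorithm for monoids in FL *)

Lemma split_count_pred (T : Type) (p : pred T) n (s : seq T) : n < count p s ->
  exists s1 e s2, [/\ s = s1 ++ e :: s2, p e & count p s1 = n].
Proof.
elim: s n => [|x s IH] n //=; case px: (p x) => /=; last first.
  rewrite add0n => /IH [s1 [e [s2 [-> pe <-]]]].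
  by exists (x :: s1), e, s2; rewrite /= px.
case: n => [_|n]; first by exists [::], x, s.
rewrite add1n ltnS => /IH [s1 [e [s2 [-> pe <-]]]].
by exists (x :: s1), e, s2; rewrite /= px.
Qed.

Section FLAlgorithm.
Variable M : finMonoidType.
Hypothesis FLM : FL M.
Local Open Scope group_scope.

Variable N : nat.
Hypothesis ltMN : (#|{: M}| < N)%N.
Let K := (#|{: M}| * (N + N))%N.

(* The value 1 stands for an unknown letter, so forgetting a letter is replacing
   it with 1. *)
Definition mul_support n (f : {ffun 'I_n -> M}) : {set 'I_n} := [set i | f i != 1]%SET.

Lemma count_index_enum (T : finType) (p : pred T) : count p (index_enum T) = #|p|.
Proof. by rewrite -sum1_card sum1_count. Qed.

(** By pigeonhole some [a != 1] is stored more than [N + N] times, and the occurrence [e] with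
    exactly [N] before it is middle. It can be forgotten by [FL_delete] whatever letters [g] later
    brings to the unknown positions. *)
Lemma shrink_once n (f : {ffun 'I_n -> M}) : (K < #|mul_support f|)%N ->
  exists f' : {ffun 'I_n -> M}, [/\ (#|mul_support f'| < #|mul_support f|)%N,
    mul_support f' \subset mul_support f &
    forall g : 'I_n -> M, (forall i, f i != 1 -> g i = 1) ->
      \prod_(i < n) (f i * g i) = \prod_(i < n) (f' i * g i)].
Proof.
move=> big.
have [a a1 ca] : exists2 a, a != 1 & (N + N < #|[pred i | f i == a]|)%N.
  apply: contrapT => h; move: big; rewrite ltnNge => /negP; apply.
  rewrite -sum1_card (partition_big f predT) //= /K -sum_nat_const.
  apply: leq_sum => a _; rewrite sum1_card.
  have [->|a1] := eqVneq a 1.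
    by rewrite eq_card0 // => i; rewrite unfold_in /= inE andNb.
  rewrite leqNgt; apply/negP => lt; apply: h; exists a => //.
  apply: leq_trans lt (subset_leq_card _); apply/fintype.subsetP => i.
  by rewrite unfold_in /= => /andP[_]; rewrite inE.
rewrite -[ltnRHS]count_index_enum in ca.
have [|s1 [e [s2 [es pe c1]]]] :=
    @split_count_pred _ [pred i | f i == a] N (index_enum 'I_n).
  by apply: leq_ltn_trans ca; rewrite leq_addr.
have fe : f e = a by apply/eqP.
have c2 : (N <= count [pred i | f i == a] s2)%N.
  by move: ca; rewrite es count_cat c1 /= fe eqxx; lia.
pose f' : {ffun 'I_n -> M} := [ffun i => if i == e then 1 else f i].
have f'E i : f' i = if i == e then 1 else f i by rewrite ffunE.
have sub : mul_support f' \subset mul_support f :\ e.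
  by apply/fintype.subsetP => i; rewrite !inE f'E; case: (i == e); rewrite ?eqxx.
exists f'; split.
- apply: leq_ltn_trans (subset_leq_card sub) _.
  by rewrite [ltnRHS](cardsD1 e) inE fe a1.
- by apply: fintype.subset_trans sub (subsetDl _ _).
move=> g hg; have := index_enum_uniq 'I_n; rewrite es cat_uniq /= negb_or.
move=> /and3P[_ /andP[es1 _] /andP[es2 _]].
have off s : e \notin s -> \prod_(i <- s) (f' i * g i) = \prod_(i <- s) (f i * g i).
  move=> he; apply: eq_big_seq => i si; rewrite f'E; case: eqP => // ei.
  by rewrite -ei si in he.
rewrite !big_cat !big_cons /= !off // f'E eqxx fe hg ?fe // mulg1 mulg1 mul1g.
have cnt s :
    (count [pred i | f i == a] s <= count_mem a [seq (f i * g i)%g | i <- s])%N.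
  rewrite count_map; apply: sub_count => i /= /eqP fi.
  by rewrite hg ?fi // mulg1.
have := @FL_delete M a [seq f i * g i | i <- s1] [seq f i * g i | i <- s2] FLM.
rewrite !big_cat big_cons /= !big_map; apply.
  by apply: leq_trans (cnt s1); rewrite c1.
by apply: leq_trans (cnt s2); apply: leq_trans c2.
Qed.

Lemma shrink_exists n (f : {ffun 'I_n -> M}) :
  exists f' : {ffun 'I_n -> M}, [/\ (#|mul_support f'| <= K)%N,
    mul_support f' \subset mul_support f &
    forall g : 'I_n -> M, (forall i, f i != 1 -> g i = 1) ->
      \prod_(i < n) (f i * g i) = \prod_(i < n) (f' i * g i)].
Proof.
have [m] := ubnP #|mul_support f|; elim: m f => // m IH f lt.
have [small|big] := leqP #|mul_support f| K; first by exists f.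
have [f1 [lt1 sub1 e1]] := shrink_once big.
have [|f2 [le2 sub2 e2]] := IH f1; first by apply: leq_trans lt1 _.
exists f2; split=> //; first exact: fintype.subset_trans sub2 sub1.
move=> g hg; rewrite e1 // e2 // => i fi; apply: hg.
by have /fintype.subsetP/(_ i) := sub1; rewrite !inE; apply.
Qed.

Definition sparse n : finType := {f : {ffun 'I_n -> M} | (#|mul_support f| <= K)%N}.

Definition shrink n (f : {ffun 'I_n -> M}) : sparse n :=
  let e := cid (shrink_exists f) in
  exist _ (projT1 e) (let: And3 h _ _ := projT2 e in h).

Lemma shrink_support n (f : {ffun 'I_n -> M}) :
  mul_support (val (shrink f)) \subset mul_support f.
Proof. by rewrite /shrink /=; case: (cid _) => f1 []. Qed.

Lemma shrink_prod n (f : {ffun 'I_n -> M}) (g : 'I_n -> M) :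
  (forall i, f i != 1 -> g i = 1) ->
  \prod_(i < n) (f i * g i) = \prod_(i < n) (val (shrink f) i * g i).
Proof. by rewrite /shrink /=; case: (cid _) => f1 [p1 p2 h] /=; apply: h. Qed.

Definition FL_algorithm : algorithm M :=
  @Algorithm M sparse (fun n => shrink [ffun => 1])
    (fun n q x i => shrink [ffun j => if j == i then x else val q j])
    (fun n q => \prod_(i < n) val q i).

Lemma FL_algorithm_correct : correct FL_algorithm.
Proof.
move=> n w pi _; rewrite /run [output _]/=.
(* [D] lists the positions read and [l] those to come. The invariant is that the stored letters,
   completed by [w] outside [D], have the product of [w]; forgotten positions of [D] contribute
   [1]. *)
have inv (l D : seq 'I_n) (q : sparse n) : uniq (l ++ D) ->
    (forall j, j \in l ++ D) -> (forall j, val q j != 1 -> j \in D) ->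
    \prod_(i < n) (val q i * (if i \in D then 1 else w i)) = \prod_(i < n) w i ->
    \prod_(i < n) val (foldl (fun q e => update (a := FL_algorithm) q e.1 e.2) q
       [seq (w i, i) | i <- l]) i = \prod_(i < n) w i.
  elim: l D q => [|i l IH] D q /=.
    by move=> _ allD _ <-; apply: eq_bigr => i _; rewrite allD mulg1.
  move=> /andP[iD uD] allD sq eq; apply: (IH (i :: D)).
  - move: iD uD; rewrite !cat_uniq /= !mem_cat !negb_or.
    by move=> /andP[-> ->] /and3P[-> -> ->]; rewrite andbT.
  - by move=> j; have := allD j; rewrite !(inE, mem_cat) orbCA.
  - move=> j hj; have /fintype.subsetP/(_ j) :=
      shrink_support [ffun j => if j == i then w i else val q j].
    rewrite !inE !ffunE hj => /(_ isT).
    by case: (j =P i) => // _; apply: sq.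
  - rewrite -[RHS]eq -shrink_prod => [|j].
      apply: eq_bigr => j _; rewrite ffunE inE; case: eqP => //= ->.
      have -> : val q i = 1.
        by apply/eqP; apply: contraNT iD => /sq iD; rewrite mem_cat iD orbT.
      rewrite mulg1 mul1g; case: ifP => // iD'.
      by rewrite mem_cat iD' orbT in iD.
    by rewrite ffunE inE; case: (j =P i) => //= _ /sq ->.
rewrite stream_enum; apply: (inv _ [::]).
- by rewrite cats0 (perm_uniq (perm_map_enum pi)) enum_uniq.
- by move=> j; rewrite cats0 (perm_mem (perm_map_enum pi)) mem_enum.
- move=> j; have /fintype.subsetP/(_ j) :=
    shrink_support ([ffun => 1] : {ffun 'I_n -> M}).
  by rewrite !inE ffunE eqxx => h /h.
- rewrite -shrink_prod => [|j]; last by rewrite ffunE eqxx.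
  by apply: eq_bigr => j _; rewrite ffunE mul1g.
Qed.

(** The stored (position, letter) pairs, padded with [None] to the fixed length [K]. *)
Definition sparse_code n (f : sparse n) : K.-tuple (option ('I_n * M)) :=
  [tuple nth None [seq Some (i, val f i) | i <- enum (mul_support (val f))] k | k < K].

Lemma mem_sparse_code n (f : sparse n) i x :
  (Some (i, x) \in sparse_code f) = (x != 1) && (val f i == x).
Proof.
apply/mapP/andP => [[k _] e|[x1 /eqP fi]].
  have ks : (k < size [seq Some (i, val f i) | i <- enum (mul_support (val f))])%N.
    by rewrite ltnNge; apply/negP => h; rewrite nth_default in e.
  have := mem_nth None ks; rewrite -e => /mapP[j]; rewrite mem_enum inE.
  by move=> fj [-> ->]; rewrite fj eqxx.
have /(nthP None) [k ks ek] :
    Some (i, x) \in [seq Some (i, val f i) | i <- enum (mul_support (val f))].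
  by apply/mapP; exists i; rewrite ?mem_enum ?inE fi.
have kK : (k < K)%N.
  by apply: leq_trans ks _; rewrite size_map -cardE (valP f).
by exists (Ordinal kK); rewrite ?mem_enum.
Qed.

Lemma sparse_code_inj n : injective (@sparse_code n).
Proof.
move=> f g e; apply/val_inj/ffunP => i.
have h (f' g' : sparse n) : sparse_code f' = sparse_code g' ->
    val f' i != 1 -> val g' i = val f' i.
  move=> e' fi; have : Some (i, val f' i) \in sparse_code f'.
    by rewrite mem_sparse_code fi eqxx.
  by rewrite e' mem_sparse_code fi => /eqP.
have [f1|/(h f g e)//] := eqVneq (val f i) 1.
have [-> //|/(h g f (esym e))] := eqVneq (val g i) 1.
by [].
Qed.

(** Each of the [K] entries takes at most [n * #|M| + 1] values, and this is at most
    [n.+1 ^ #|M|.+1] because [#|M| < n.+1 ^ #|M|]. *)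
Lemma card_sparse n : (0 < n)%N -> (#|sparse n| <= n.+1 ^ (#|{: M}|.+1 * K))%N.
Proof.
move=> n0; apply: (leq_trans (leq_card _ (@sparse_code_inj n))).
rewrite card_tuple card_option card_prod card_ord expnM.
case: K => [//|k]; rewrite leq_exp2r // expnS.
have h : (#|{: M}| < n.+1 ^ #|{: M}|)%N by apply: ltn_expl.
apply: leq_trans (leq_mul (leqnn n.+1) h); rewrite mulSn mulnS addSn ltnS.
by rewrite addnCA addnA leq_addl.
Qed.

End FLAlgorithm.

Lemma FL_poly_space (M : finMonoidType) : FL M -> poly_space M.
Proof.
move=> FLM; have ltMN := ltnSn #|{: M}|.
exists (FL_algorithm FLM ltMN); eexists; split; first exact: FL_algorithm_correct.
exact: card_sparse.
Qed.

Lemma variety_join_poly_space (M : finMonoidType) :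
  variety_join FL Com M -> poly_space M.
Proof.
by apply; [exact: poly_space_variety | exact: FL_poly_space | exact: Com_poly_space].
Qed.

(** * Lower bounds *)

Lemma perm_of_enum n (s : seq 'I_n) : perm_eq s (enum 'I_n) ->
  exists pi : {perm 'I_n}, [seq pi i | i <- enum 'I_n] = s.
Proof.
move=> ps; have : perm_eq s (ord_tuple n) by rewrite val_ord_tuple.
move/tuple_permP => [p ->]; exists p; apply: eq_map => i.
by rewrite tnth_ord_tuple.
Qed.

Section LowerBound.
Variable M : finMonoidType.
Local Open Scope group_scope.

Definition mix n (S : {set 'I_n}) (f g : 'I_n -> M) i := if i \in S then f i else g i.

(* The stream lists S first, so the states reached after S must separate words
   that some completion outside S separates. *)
Lemma fooling (A : algorithm M) n (I : finType) (S : {set 'I_n}) (F : I -> 'I_n -> M) :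
  correct A -> (0 < n)%N ->
  (forall k l, k != l -> exists g,
     \prod_(i < n) mix S (F k) g i <> \prod_(i < n) mix S (F l) g i) ->
  (#|I| <= #|state A n|)%N.
Proof.
move=> cA n0 sep.
apply: (@leq_card _ _ (fun k => run A [seq (F k i, i) | i <- enum S])) => k l eq.
apply/eqP; apply: contraT => /sep [g]; case.
have [|pi epi] := @perm_of_enum n (enum S ++ enum (~: S)).
  apply: uniq_perm; rewrite ?enum_uniq // ?cat_uniq ?enum_uniq ?andbT /=.
    by apply/hasPn => i; rewrite !mem_enum inE.
  by move=> i; rewrite mem_cat !mem_enum !inE orbN.
have streamE h : stream (mix S h g) pi =
    [seq (h i, i) | i <- enum S] ++ [seq (g i, i) | i <- enum (~: S)].
  rewrite stream_enum epi map_cat.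
  congr (_ ++ _); apply/eq_in_map => i; rewrite mem_enum ?inE /mix.
    by move=> ->.
  by move=> /negPf ->.
rewrite -!(cA n _ pi n0) !streamE /run !foldl_cat.
by congr (output (foldl _ _ _)).
Qed.

Lemma prod_split m i (f : nat -> M) : (i < m)%N ->
  \prod_(0 <= j < m) f j = \prod_(0 <= j < i) f j * f i * \prod_(i.+1 <= j < m) f j.
Proof.
by move=> im; rewrite (big_cat_nat (n := i)) ?(ltnW im) //= (big_ltn im) mulgA.
Qed.

Lemma prod_blocks b m (f : nat -> M) :
  \prod_(0 <= j < m * b) f j = \prod_(0 <= j < m) \prod_(0 <= r < b) f (j * b + r)%N.
Proof.
elim: m => [|m IH]; first by rewrite !big_geq.
rewrite big_nat_recr //= -IH mulSnr (big_cat_nat (n := (m * b)%N)) ?leq_addr //=.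
congr (_ * _); rewrite -{1}[(m * b)%N]add0n big_addn addKn.
by apply: eq_bigr => r _; rewrite addnC.
Qed.

Lemma prod_const_nat (c : M) (f : nat -> M) a b :
  (forall j, (a <= j < b)%N -> f j = c) -> \prod_(a <= j < b) f j = c ^+ (b - a).
Proof.
move=> h; rewrite (eq_big_nat _ _ h) big_const_nat.
by elim: (b - a)%N => //= k ->; rewrite expgS.
Qed.

Lemma prod_one (f : nat -> M) a b :
  (forall j, (a <= j < b)%N -> f j = 1) -> \prod_(a <= j < b) f j = 1.
Proof. by move=> h; rewrite (prod_const_nat h) expg1n. Qed.

(** The even positions come first, with a single [x] in block [k]. For [k < l], a [y] at the odd
    position of block [k] gives [x * y] for the index [k] and [y * x] for [l]. *)
Lemma noncommutative_states (A : algorithm M) m : correct A -> ~ Com M ->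
  (0 < m)%N -> (m <= #|state A (m * 2)|)%N.
Proof.
move=> cA nC m0.
have [x [y xy]] : exists x y : M, x * y <> y * x.
  apply: contrapT => h; apply: nC => x y; apply: contrapT => e.
  by apply: h; exists x, y.
rewrite -[m in (m <= _)%N]card_ord.
pose S : {set 'I_(m * 2)} := [set i : 'I_(m * 2) | ~~ odd i]%SET.
pose F (k : 'I_m) (i : 'I_(m * 2)) : M := if i == (k * 2)%N :> nat then x else 1.
apply: (@fooling A _ _ S F cA); first by rewrite muln_gt0 m0.
pose G (k : nat) (i : 'I_(m * 2)) : M := if i == (k * 2).+1 :> nat then y else 1.
have prodE (k l : 'I_m) : \prod_(i < m * 2) mix S (F k) (G l) i =
    \prod_(0 <= j < m)
      ((if j == k :> nat then x else 1) * (if j == l :> nat then y else 1)).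
  pose f i := if ~~ odd i then if i == (k * 2)%N :> nat then x else 1
              else if i == (l * 2).+1 :> nat then y else 1.
  transitivity (\prod_(i < m * 2) f i).
    by apply: eq_bigr => i _; rewrite /mix inE.
  rewrite -(big_mkord xpredT f) prod_blocks; apply: eq_bigr => j _.
  rewrite big_nat_recl // big_nat1 /f addn0 addn1 /= muln2 odd_double /=.
  by rewrite -!muln2 eqSS !eqn_pmul2r.
have sep (k l : 'I_m) : (k < l)%N ->
    \prod_(i < m * 2) mix S (F k) (G k) i <> \prod_(i < m * 2) mix S (F l) (G k) i.
  move=> kl; rewrite !prodE (prod_split _ (ltn_ord k)) eqxx.
  rewrite (prod_split _ (ltn_ord l)) eqxx (prod_split _ kl) eqxx.
  rewrite (ltn_eqF kl) (gtn_eqF kl) !prod_one ?mul1g ?mulg1 // => j /andP[h1 h2];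
    by do 2?[case: (@eqP _ j _) => [e|_]; first by exfalso; lia]; rewrite mulg1.
move=> k l; rewrite neq_ltn => /orP[kl|lk]; first by exists (G k); apply: sep.
by exists (G l) => e; apply: (sep _ _ lk).
Qed.

(* Blocks have 5 positions. T chooses which of positions 1 and 3 carries x; the
   completion fills positions 0, 2 and 4. *)
Lemma unmovable_states (A : algorithm M) m : correct A -> ~ moves M ->
  (0 < m)%N -> (2 ^ m <= #|state A (m * 5)|)%N.
Proof.
move=> cA nE m0; set w := idempotent_power M.
have [x [y [z [s [t]]]]] : exists x y z s t : M,
   (x * y) ^+ w * s * x * t * (x * z) ^+ w <> (x * y) ^+ w * s * t * x * (x * z) ^+ w.
  apply: contrapT => h; apply: nE => x y z s t; apply: contrapT => e; apply: h.
  by exists x, y, z, s, t.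
set e := (x * y) ^+ w; set f := (x * z) ^+ w => neq.
have wE (c : M) : c * c ^+ w.-1 = c ^+ w.
  by rewrite -expgS prednK // idempotent_power_gt0.
have -> : (2 ^ m = #|{: m.-tuple bool}|)%N by rewrite card_tuple card_bool.
pose S : {set 'I_(m * 5)} := [set i : 'I_(m * 5) | odd (i %% 5)]%SET.
pose F (T : m.-tuple bool) (i : nat) : M :=
  if nth false T (i %/ 5) == (i %% 5 == 1)%N then x else 1.
(* Outside block [k] the last position completes [x] to [(x * y) ^+ w] or [(x * z) ^+ w], whichever
   slot holds [x]. Block [k] carries [e * s], [t] and [f] around its two slots, and the idempotents
   [e] and [f] absorb the other blocks. *)
pose G (k i : nat) : M := let j := (i %/ 5)%N in
  if (j < k)%N then (if (i %% 5 == 4)%N then y * (x * y) ^+ w.-1 else 1)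
  else if j == k then nth 1 [:: e * s; 1; t; 1; f] (i %% 5)
  else (if (i %% 5 == 4)%N then z * (x * z) ^+ w.-1 else 1).
apply: (@fooling A _ _ S (fun T i => F T i) cA); first by rewrite muln_gt0 m0.
have prodE (T : m.-tuple bool) (k : nat) : (k < m)%N ->
    \prod_(i < m * 5) mix S (fun i => F T i) (fun i => G k i) i =
    if nth false T k then e * s * x * t * f else e * s * t * x * f.
  move=> km; pose h i := if odd (i %% 5) then F T i else G k i.
  transitivity (\prod_(i < m * 5) h i).
    by apply: eq_bigr => i _; rewrite /mix inE.
  have divE j r : (r < 5)%N -> ((j * 5 + r) %/ 5 = j)%N.
    by move=> r5; rewrite divnMDl // divn_small // addn0.
  have modE j r : (r < 5)%N -> ((j * 5 + r) %% 5 = r)%N.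
    by move=> r5; rewrite modnMDl modn_small.
  rewrite -(big_mkord xpredT h) prod_blocks.
  have blockE j : \prod_(0 <= r < 5) h (j * 5 + r)%N =
     if (j < k)%N then e else if j == k then
       if nth false T j then e * s * x * t * f else e * s * t * x * f
     else f.
    rewrite 5?big_nat_recl // big_geq // /h /F /G !divE ?modE //=.
    case: ltngtP => _; case: (nth false T j) => /=; rewrite ?mulg1 ?mul1g ?mulgA //.
  under eq_bigr do rewrite blockE.
  rewrite (prod_split _ km) ltnn eqxx.
  rewrite (@prod_const_nat e) => [|j /andP[_ ->]//].
  rewrite (@prod_const_nat f) => [|j /andP[kj _]]; last first.
    by rewrite ltnNge (ltnW kj) gtn_eqF.
  have eX n : e ^+ n * e = e by rewrite -expgSr -expgnA mulnC expg_mul_idempotent.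
  have fX n : f * f ^+ n = f by rewrite -expgS -expgnA mulnC expg_mul_idempotent.
  by case: ifP => _; rewrite !mulgA eX -!mulgA fX.
move=> T U TU.
have [k km Tk] : exists2 k, (k < m)%N & nth false T k != nth false U k.
  apply: contrapT => h; move/eqP: TU; apply; apply/val_inj.
  apply: (@eq_from_nth _ false); rewrite ?size_tuple // => i im.
  by apply/eqP; apply: contrapT => ne; apply: h; exists i => //; apply/negP.
exists (fun i => G k i); rewrite !prodE //.
by case: (nth false T k) (nth false U k) Tk => [] [] // _ h; apply: neq; rewrite ?h.
Qed.

End LowerBound.

(** * Asymptotics *)

Local Open Scope classical_set_scope.
Local Open Scope ring_scope.

Section Asymptotics.
Variable R : realType.
Implicit Types f g : nat -> R.

(** Every neighbourhood of infinity contains a tail, hence an [n] with ratio at least [c], so each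
    supremum in the upper limit is at least [c]. *)
Lemma HL_Omega_frequently f g (c : R) : 0 < c ->
  (forall n0, exists2 n, (n0 <= n)%N & c <= f n / g n) -> HL_Omega f g.
Proof.
move=> c0 freq; apply: (@lt_le_trans _ _ c%:E); first by rewrite lte_fin.
apply: le_ereal_inf_tmp => _ [V [n0 _ subV] <-].
have [n n0n le] := freq n0.
apply: (@le_trans _ _ (f n / g n)%:E); first by rewrite lee_fin.
by apply: ereal_sup_ubound; exists n => //; apply: subV.
Qed.

Lemma eqO_bounded (f : nat -> R) (g : nat -> R) (k : R) n0 : 0 < k ->
  (forall n, (n0 <= n)%N -> `|f n| <= k * `|g n|) -> f =O_\oo g.
Proof.
by move=> k0 h; apply/eqO_exP; exists k => //; exists n0 => // n; apply: h.
Qed.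

Variable M : finMonoidType.

Lemma Com_space : Com M -> space_bigO M (fun _ : nat => 1 : R).
Proof.
move=> cM; exists (Com_algorithm M), (fun _ => #|{: M}|); split.
- exact: Com_algorithm_correct.
- by move=> n _; apply: ltnW; apply: ltn_expl.
- apply: (@eqO_bounded _ _ (#|{: M}|%:R + 1) 0) => [|n _]; first by rewrite ltr_wpDl.
  by rewrite normr1 mulr1 ger0_norm // lerDl.
Qed.

Lemma poly_space_log : poly_space M -> space_bigO M (fun n : nat => ln (n%:R : R)).
Proof.
move=> [A [c [cA sA]]]; exists A, (fun n => c * up_log 2 n.+1)%N; split=> //.
- move=> n n0; apply: leq_trans (sA n n0) _.
  by rewrite mulnC expnM; case: c {sA} => // c; rewrite leq_exp2r //; apply: up_logP.
have ln2 : 0 < ln (2 : R) by rewrite ln_gt0 // ltr1n.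
(* For [n >= 2], [2 ^ up_log 2 n.+1 <= 2 * n <= n ^ 2] gives the factor [2 / ln 2]. Taking [c.+1]
   keeps the constant positive when [c] is [0]. *)
apply: (@eqO_bounded _ _ ((c.+1)%:R * (2 / ln 2)) 2) => [|n n2].
  by rewrite mulr_gt0 // divr_gt0.
have lnn : ln (2 : R) <= ln n%:R by rewrite ler_ln ?posrE ?ltr0n ?ler_nat //; lia.
rewrite (ger0_norm (ltW (lt_le_trans ln2 lnn))) ger0_norm // natrM -mulrA.
apply: ler_pM => //; first by rewrite ler_nat.
rewrite mulrAC ler_pdivlMr //.
have n1 : (1 < n.+1)%N by rewrite ltnS ltnW.
have le2 : (2 ^ (up_log 2 n.+1) <= n ^ 2)%N.
  rewrite -(@prednK (up_log 2 n.+1)) ?up_log_gt0 // expnS -mulnn.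
  by rewrite leq_mul // -ltnS up_log_gtn.
have : ln ((2 ^ up_log 2 n.+1)%N%:R : R) <= ln (n ^ 2)%N%:R.
  by rewrite ler_ln ?posrE ?ltr0n ?ler_nat ?expn_gt0 // ltnW.
rewrite (natrX R 2) (natrX R n) !lnXn ?ltr0n ?(ltnW n2) //.
by rewrite !mulr_natl.
Qed.

Lemma linear_space : space_bigO M (fun n : nat => n%:R : R).
Proof.
pose A := @Algorithm M (fun n => {ffun 'I_n -> M} : finType) (fun n => [ffun => 1%g])
  (fun n q x i => [ffun j => if j == i then x else q j])
  (fun n q => (\prod_(i < n) q i)%g).
exists A, (fun n => #|{: M}| * n)%N; split.
- move=> n w pi _; rewrite /run.
  (* Entry [j] ends up correct if it is already stored or still to be read. *)
  have inv (l : seq 'I_n) (q : {ffun 'I_n -> M}) j : q j = w j \/ j \in l ->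
      foldl (fun q e => update (a := A) q e.1 e.2) q [seq (w i, i) | i <- l] j = w j.
    elim: l q => [|i l IH] q /=; first by case.
    rewrite inE => h; apply: IH; rewrite ffunE.
    case: (j =P i) => [->|ne]; first by left.
    by case: h => [|/predU1P[/ne//|]]; [left | right].
  rewrite /=; apply: eq_bigr => j _; rewrite stream_enum inv //; right.
  by rewrite (perm_mem (perm_map_enum pi)) mem_enum.
- move=> n _; rewrite card_ffun card_ord expnM.
  case: n => // n; rewrite leq_exp2r //; exact/ltnW/ltn_expl.
- apply: (@eqO_bounded _ _ (#|{: M}|%:R + 1) 0) => [|n _]; first by rewrite ltr_wpDl.
  by rewrite !ger0_norm // natrM ler_wpM2r // lerDl.
Qed.

Lemma noncommutative_space : ~ Com M -> space_bigOmega M (fun n : nat => ln (n%:R : R)).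
Proof.
move=> nC A s cA sA.
have ln2 : 0 < ln (2 : R) by rewrite ln_gt0 // ltr1n.
(* At length [m * 2] with [m >= 2], [ln (m * 2) <= 2 * ln m], while [m] states force
   [ln m <= s * ln 2]. *)
apply: (@HL_Omega_frequently _ _ (2 * ln 2)^-1) => [|n0].
  by rewrite invr_gt0 mulr_gt0.
pose m := n0.+2; exists (m * 2)%N; first by rewrite /m; lia.
have le : (m <= 2 ^ s (m * 2))%N.
  by apply: leq_trans (noncommutative_states cA nC _) (sA _ _); rewrite ?muln_gt0.
have lnm : ln (m%:R : R) <= (s (m * 2)%N)%:R * ln 2.
  have : ln (m%:R : R) <= ln (2 ^ s (m * 2))%N%:R.
    by rewrite ler_ln ?posrE ?ltr0n ?ler_nat ?expn_gt0.
  by rewrite natrX lnXn ?ltr0n // mulr_natl.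
have ln2m : ln (2 : R) <= ln m%:R by rewrite ler_ln ?posrE ?ltr0n ?ler_nat.
have -> : ln ((m * 2)%N%:R : R) = ln m%:R + ln 2 by rewrite natrM lnM ?posrE ?ltr0n.
rewrite ler_pdivlMr; last by rewrite addr_gt0 // (lt_le_trans ln2).
rewrite ler_pdivrMl ?mulr_gt0 // -mulrA [ln 2 * _]mulrC.
by apply: le_trans (lerD lnm (le_trans ln2m lnm)) _; rewrite (mulr_natl _ 2) mulr2n.
Qed.

Lemma unmovable_space : ~ moves M -> space_bigOmega M (fun n : nat => n%:R : R).
Proof.
move=> nE A s cA sA.
(* Length [m * 5] requires at least [m] bits. *)
apply: (@HL_Omega_frequently _ _ 5^-1) => [|n0]; first by rewrite invr_gt0.
pose m := n0.+1; exists (m * 5)%N; first by rewrite /m; lia.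
have le : (2 ^ m <= 2 ^ s (m * 5))%N.
  by apply: leq_trans (unmovable_states cA nE _) (sA _ _); rewrite ?muln_gt0.
rewrite leq_exp2l // in le.
rewrite ler_pdivlMr ?ltr0n // natrM mulrCA mulVf ?pnatr_eq0 // mulr1 ler_nat //.
Qed.

End Asymptotics.

Theorem theorem3p2 (R : realType) (M : finMonoidType) :
  [/\ Com M -> space_bigO M (fun _ : nat => 1 : R),
      variety_join FL Com M /\ ~ Com M ->
        space_bigTheta M (fun n : nat => ln (n%:R : R))
    & ~ variety_join FL Com M ->
        space_bigTheta M (fun n : nat => n%:R : R)].
Proof.
split.
- exact: Com_space.
- move=> [/variety_join_poly_space/poly_space_log ? ?].
  by split => //; apply: noncommutative_space.
- move=> nV; split; first exact: linear_space.
  by apply: unmovable_space => /moves_variety_join.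
Qed.
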